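(* Let $R$ be a maximal subring of a ring $T$ such that $R$ is $2$-integrally closed in $T$, or, alternatively, such that for every $x\in T$ with $x^2\in R$ one has $x\in R$. Then $(R:T)$ is a semiprime ideal of $T$. Moreover, either $(R:T)$ is a prime ideal of $T$ or $(R:T)=(R:T)_l\cap (R:T)_r$ (which is then a semiprime ideal of $R$).
   Context: All rings are associative, unital with $1\neq 0$, and not necessarily commutative; subrings contain the identity of the overring. A subring $R\subsetneq T$ is a maximal subring of $T$ if there is no subring $S$ with $R\subsetneq S\subsetneq T$. $(R:T):=\{x\in T\mid TxT\subseteq R\}$, $(R:T)_l:=\{x\in T\mid Tx\subseteq R\}$ and $(R:T)_r:=\{x\in T\mid xT\subseteq R\}$ are respectively the largest two-sided, left and right ideal of $T$ contained in $R$. An element $t\in T$ is left (resp. right) $n$-integral over $R$ ($n\ge 1$) if it is a root of a monic polynomial of degree $n$ with coefficients from $R$ written on the left (resp. right), i.e. $t^n+r_{n-1}t^{n-1}+\cdots+r_0=0$ (resp. $t^n+t^{n-1}r_{n-1}+\cdots+r_0=0$) for some $r_i\in R$. $R$ is $n$-integrally closed in $T$ if every element of $T$ that is left $n$-integral or right $n$-integral over $R$ belongs to $R$; $R$ is integrally closed in $T$ if it is $n$-integrally closed in $T$ for every $n\ge1$. *)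

(* Defs.v *)
From mathcomp Require Import all_boot all_algebra.
From mathcomp Require Import classical_sets.

Set Implicit Arguments.
Unset Strict Implicit.
Unset Printing Implicit Defensive.

Import GRing.Theory.

Local Open Scope classical_set_scope.
Local Open Scope ring_scope.

Definition maximal_subring (T : nzRingType) (R : set T) : Prop :=
  [/\ GRing.subring_closed [in R],
      R `<` setT &
      ~ exists S : set T, [/\ GRing.subring_closed [in S], R `<` S & S `<` setT]].

Definition conductor (T : nzRingType) (R : set T) : set T :=
  [set x | forall a b : T, R (a * x * b)].

Definition lconductor (T : nzRingType) (R : set T) : set T :=
  [set x | forall a : T, R (a * x)].

Definition rconductor (T : nzRingType) (R : set T) : set T :=
  [set x | forall b : T, R (x * b)].

Definition left_integral (T : nzRingType) (R : set T) (n : nat) (t : T) : Prop :=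
  exists r : 'I_n -> T,
    (forall i, R (r i)) /\ t ^+ n + \sum_(i < n) r i * t ^+ i = 0.

Definition right_integral (T : nzRingType) (R : set T) (n : nat) (t : T) : Prop :=
  exists r : 'I_n -> T,
    (forall i, R (r i)) /\ t ^+ n + \sum_(i < n) t ^+ i * r i = 0.

Definition n_integrally_closed (T : nzRingType) (R : set T) (n : nat) : Prop :=
  forall t : T, left_integral R n t \/ right_integral R n t -> R t.

(* Ideals of a subring S of T are represented as subsets of T, so that ideals
   of T itself are obtained with S := setT. The ideals of ring_quotient are
   one-sided and proper by definition, and its prime ideals are completely
   prime, hence not suited to noncommutative rings. *)
Definition ideal_of (T : nzRingType) (S I : set T) : Prop :=
  [/\ I `<=` S,
      zmod_closed [in I] &
      forall s x, S s -> I x -> I (s * x) /\ I (x * s)].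

Definition ideal_mul (T : nzRingType) (I J : set T) : set T :=
  [set x | exists s : seq (T * T),
     (forall p, p \in s -> I p.1 /\ J p.2) /\ x = \sum_(p <- s) p.1 * p.2].

Definition prime_ideal_of (T : nzRingType) (S P : set T) : Prop :=
  [/\ ideal_of S P,
      P <> S &
      forall I J, ideal_of S I -> ideal_of S J ->
        ideal_mul I J `<=` P -> I `<=` P \/ J `<=` P].

(* As is usual, the unit ideal is not excluded here. *)
Definition semiprime_ideal_of (T : nzRingType) (S P : set T) : Prop :=
  ideal_of S P /\
  forall I, ideal_of S I -> ideal_mul I I `<=` P -> I `<=` P.

(* Main.v *)
Require Import Defs.
From mathcomp Require Import all_boot all_algebra.
From mathcomp Require Import boolp classical_sets.

Import GRing.Theory.

Local Open Scope classical_set_scope.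
Local Open Scope ring_scope.

(** Let R be a maximal subring of T. Either closedness hypothesis gives:
    x ^+ 2 in R implies x in R. Write C for the conductor (R : T), the largest
    ideal of T contained in R.

    If I is an ideal of T with I I inside C, every x in I satisfies
    x ^+ 2 in R, so I is inside R and therefore inside C: C is semiprime in T.

    Suppose that C is not prime, say I J is inside C while neither I nor J is.
    Then neither is contained in R, so maximality gives T = R + I = R + J
    ([maximal_subring_decomp]). If T x and x T are both contained in R, then
    for a = r + i and b = s + j (r, s in R, i in I, j in J) the three terms of
      a x b = r (x b) + (i x) s + (i x) j
    lie in R, the last one because it is in I J; so x is in C
    ([capLR_sub_conductor]). Finally, let K be an ideal of R with K K inside C
    and let x be in K. For i in I write i = r + j with r in R and j in J; then
      (i x)^2 = i (x r x) + i (x j x)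
    lies in C, as x r x is in K K and i (x j x) is in I J. Hence i x is in R,
    and T x = (R + I) x is inside R. Symmetrically x T = x (R + J) is inside R
    ([square_sub_capLR]). *)

Section Subrings.

Set Implicit Arguments.
Unset Strict Implicit.

Variables (T : nzRingType) (R : set T).

(** The closure predicates are stated on the boolean predicate [in I]; this and
    the next lemma restate them on the set itself. *)
Lemma zmod_closed_set (I : set T) :
  zmod_closed [in I] <-> I 0 /\ (forall x y, I x -> I y -> I (x - y)).
Proof.
split=> -[I0 IB].
  split; first by move: I0; rewrite inE.
  by move=> x y Ix Iy; have := IB x y; rewrite !inE; apply.
by split=> [|x y]; rewrite !inE //; apply: IB.
Qed.

Lemma subring_closed_set (S : set T) :
  GRing.subring_closed [in S] <->
  [/\ S 1, forall x y, S x -> S y -> S (x - y) &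
      forall x y, S x -> S y -> S (x * y)].
Proof.
split=> -[S1 SB SM].
  split; first by move: S1; rewrite inE.
    by move=> x y Sx Sy; have := SB x y; rewrite !inE; apply.
  by move=> x y Sx Sy; have := SM x y; rewrite !inE; apply.
by split=> [|x y|x y]; rewrite !inE //; [apply: SB|apply: SM].
Qed.

Lemma zmod_closed_add (I : set T) :
  zmod_closed [in I] -> forall x y, I x -> I y -> I (x + y).
Proof.
move=> /zmod_closed_set[I0 IB] x y Ix Iy.
by rewrite -[y]opprK; apply: (IB) => //; rewrite -sub0r; apply: IB.
Qed.

Lemma subring_closed_zmod (S : set T) :
  GRing.subring_closed [in S] -> zmod_closed [in S].
Proof.
move=> /subring_closed_set[S1 SB _]; apply/zmod_closed_set; split=> //.
by rewrite -(subrr 1); apply: SB.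
Qed.

Lemma ideal_mul_mem (I J : set T) x y : I x -> J y -> ideal_mul I J (x * y).
Proof.
move=> Ix Jy; exists [:: (x, y)]; rewrite big_seq1; split=> //.
by move=> p; rewrite inE => /eqP ->.
Qed.

Lemma ideal_of_mull (S I : set T) s x : ideal_of S I -> S s -> I x -> I (s * x).
Proof. by move=> [_ _ IM] Ss Ix; have [] := IM s x Ss Ix. Qed.

Lemma ideal_of_mulr (S I : set T) s x : ideal_of S I -> S s -> I x -> I (x * s).
Proof. by move=> [_ _ IM] Ss Ix; have [] := IM s x Ss Ix. Qed.

Lemma conductor_sub : conductor R `<=` R.
Proof. by move=> x /(_ 1 1); rewrite mul1r mulr1. Qed.

Lemma ideal_sub_conductor (I : set T) :
  ideal_of setT I -> I `<=` R -> I `<=` conductor R.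
Proof.
move=> idI IR x Ix a b; apply: IR.
by apply: (ideal_of_mulr idI) => //; apply: (ideal_of_mull idI).
Qed.

Lemma conductor_ideal :
  GRing.subring_closed [in R] -> ideal_of setT (conductor R).
Proof.
move=> /subring_closed_zmod /zmod_closed_set[R0 RB]; split=> //.
  apply/zmod_closed_set; split=> [a b|x y Cx Cy a b].
    by rewrite mulr0 mul0r.
  by rewrite mulrBr mulrBl; apply: RB.
by move=> s x _ Cx; split=> a b; [rewrite mulrA|rewrite -mulrA -(mulrA x) mulrA].
Qed.

Lemma ideal_of_subring (S I : set T) :
  I `<=` S -> ideal_of setT I -> ideal_of S I.
Proof. by move=> IS [_ IZ IM]; split=> // s x _; apply: IM. Qed.

Lemma conductor_sub_capLR : conductor R `<=` lconductor R `&` rconductor R.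
Proof.
move=> x Cx; split=> a; first by have := Cx a 1; rewrite mulr1.
by have := Cx 1 a; rewrite mul1r.
Qed.

Lemma int2_closed_sqr :
  GRing.subring_closed [in R] -> n_integrally_closed R 2 ->
  forall x, R (x ^+ 2) -> R x.
Proof.
move=> /subring_closed_zmod /zmod_closed_set[R0 RB] clR x Rx2.
apply: clR; left.
(* x is a root of t ^+ 2 + 0 * t - x ^+ 2 *)
exists (fun i : 'I_2 => if i == 0 then - x ^+ 2 else 0); split=> [i|].
  by case: ifP => // _; rewrite -sub0r; apply: RB.
by rewrite big_ord_recl big_ord1 /= expr0 mulr1 mul0r addr0 subrr.
Qed.

(** If I is not inside R, then R + I is a subring containing R properly, hence
    it is T. *)
Lemma maximal_subring_decomp (I : set T) :
  maximal_subring R -> ideal_of setT I -> ~ I `<=` R ->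
  forall t, exists r i, [/\ R r, I i & t = r + i].
Proof.
move=> [Rring _ maxR] idI nIR t; apply: contrapT => nt.
have [R1 RB RM] := (subring_closed_set R).1 Rring.
have [_ IZ _] := idI; have [I0 IB] := (zmod_closed_set I).1 IZ.
apply: maxR; exists [set t | exists r i, [/\ R r, I i & t = r + i]].
split; first apply/subring_closed_set; first split.
- by exists 1, 0; rewrite addr0.
- move=> _ _ [r [i [Rr Ii ->]]] [s [j [Rs Ij ->]]].
  by exists (r - s), (i - j); split; [apply: RB|apply: IB|rewrite opprD addrACA].
- move=> _ _ [r [i [Rr Ii ->]]] [s [j [Rs Ij ->]]].
  exists (r * s), (r * j + i * (s + j)); split; first exact: RM.
    apply: zmod_closed_add => //; first exact: (ideal_of_mull idI).
    exact: (ideal_of_mulr idI).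
  by rewrite mulrDl mulrDr addrA.
- split=> [r Rr|RIR]; first by exists r, 0; rewrite addr0.
  apply: nIR => i Ii; apply: RIR; exists 0, i; rewrite add0r; split=> //.
  by rewrite -(subrr 1); apply: RB.
- by split=> // /(_ t Logic.I).
Qed.

Hypothesis Rring : GRing.subring_closed [in R].
Hypothesis sqrR : forall x, R (x ^+ 2) -> R x.

Lemma conductor_semiprime : semiprime_ideal_of setT (conductor R).
Proof.
split=> [|I idI IIC]; first exact: conductor_ideal.
apply: ideal_sub_conductor => //.
move=> x Ix; apply: sqrR; apply: conductor_sub; apply: IIC.
by rewrite expr2; apply: ideal_mul_mem.
Qed.

(** The situation in which the conductor fails to be prime: I J lies in the
    conductor and T = R + I = R + J. *)
Section TwoIdeals.

Variables I J : set T.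
Hypotheses (idI : ideal_of setT I) (idJ : ideal_of setT J).
Hypothesis IJC : ideal_mul I J `<=` conductor R.
Hypothesis decI : forall t, exists r i, [/\ R r, I i & t = r + i].
Hypothesis decJ : forall t, exists r j, [/\ R r, J j & t = r + j].

Lemma capLR_sub_conductor : lconductor R `&` rconductor R `<=` conductor R.
Proof.
have [_ _ RM] := (subring_closed_set R).1 Rring.
have RD := zmod_closed_add (subring_closed_zmod Rring).
move=> x [Lx Rx] a b.
have [r [i [Rr Ii ->]]] := decI a.
rewrite mulrDl mulrDl; apply: (RD); first by rewrite -mulrA; apply: RM.
have [s [j [Rs Jj ->]]] := decJ b.
rewrite mulrDr; apply: RD; first exact: RM.
apply/conductor_sub/IJC/ideal_mul_mem => //; exact: (ideal_of_mulr idI).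
Qed.

Lemma square_sub_capLR (K : set T) :
  ideal_of R K -> ideal_mul K K `<=` conductor R ->
  K `<=` lconductor R `&` rconductor R.
Proof.
have [_ _ RM] := (subring_closed_set R).1 Rring.
have RD := zmod_closed_add (subring_closed_zmod Rring).
have idC := conductor_ideal Rring; have [_ CZ _] := idC.
have CD := zmod_closed_add CZ.
move=> idK KKC x Kx; have [KR _ _] := idK.
have CKrK r : R r -> conductor R (x * r * x).
  by move=> Rr; apply/KKC/ideal_mul_mem => //; apply: (ideal_of_mulr idK).
split=> a.
  have [r [i [Rr Ii ->]]] := decI a; rewrite mulrDl.
  apply: RD; first by apply: RM => //; apply: KR.
  (* (i x)^2 = i (x i x), in which only the inner i is replaced by s + j. *)
  have [s [j [Rs Jj eqi]]] := decJ i.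
  apply/sqrR/conductor_sub; rewrite expr2 -mulrA (mulrA x) {2}eqi.
  rewrite mulrDr mulrDl mulrDr; apply: CD.
    by apply: (ideal_of_mull idC) => //; apply: CKrK.
  apply/IJC/ideal_mul_mem => //.
  by apply: (ideal_of_mulr idJ) => //; apply: (ideal_of_mull idJ).
have [r [j [Rr Jj ->]]] := decJ a; rewrite mulrDr.
apply: RD; first by apply: RM => //; apply: KR.
(* (x j)^2 = (x j x) j, in which only the inner j is replaced by s + i. *)
have [s [i [Rs Ii eqj]]] := decI j.
apply/sqrR/conductor_sub; rewrite expr2 mulrA {1}eqj.
rewrite mulrDr mulrDl mulrDl; apply: CD.
  by apply: (ideal_of_mulr idC) => //; apply: CKrK.
apply/IJC/ideal_mul_mem => //.
by apply: (ideal_of_mulr idI) => //; apply: (ideal_of_mull idI).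
Qed.

End TwoIdeals.

End Subrings.

Theorem theorem3p6 (T : nzRingType) (R : set T)
  (maxR : maximal_subring R)
  (closedR : n_integrally_closed R 2 \/ (forall x : T, R (x ^+ 2) -> R x)) :
  semiprime_ideal_of setT (conductor R) /\
  (prime_ideal_of setT (conductor R) \/
   (conductor R = lconductor R `&` rconductor R /\
    semiprime_ideal_of R (lconductor R `&` rconductor R))).
Proof.
have [Rring [_ RneT] _] := maxR.
have sqrR x : R (x ^+ 2) -> R x.
  by case: closedR => [/(int2_closed_sqr Rring)|]; apply.
split; first exact: conductor_semiprime.
have [|nprime] := pselect (prime_ideal_of setT (conductor R)); [by left|right].
have [I [J [idI idJ IJC nIC nJC]]] : exists I J : set T,
    [/\ ideal_of setT I, ideal_of setT J, ideal_mul I J `<=` conductor R,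
        ~ I `<=` conductor R & ~ J `<=` conductor R].
  apply: contrapT => nIJ; apply: nprime; split; first exact: conductor_ideal.
    by move=> CT; apply: RneT => x _; apply: conductor_sub; rewrite CT.
  move=> I J idI idJ IJC; apply: contrapT => /not_orP[nI nJ].
  by apply: nIJ; exists I, J.
have dec K : ideal_of setT K -> ~ K `<=` conductor R ->
    forall t, exists r i, [/\ R r, K i & t = r + i].
  move=> idK nKC; apply: maximal_subring_decomp => // KR; apply: nKC.
  exact: ideal_sub_conductor.
have decI := dec I idI nIC; have decJ := dec J idJ nJC.
have CE : conductor R = lconductor R `&` rconductor R.
  rewrite eqEsubset; split; first exact: conductor_sub_capLR.
  exact: (capLR_sub_conductor Rring idI IJC).
split=> //; split.
  rewrite -CE; apply: ideal_of_subring; first exact: conductor_sub.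
  exact: conductor_ideal.
move=> K idK KKC; apply: (square_sub_capLR Rring sqrR idI idJ IJC) => //.
by rewrite CE.
Qed.
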